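(* Let $F$ be a field. Let $k,\ell$ be integers with $k>0$ and $0\le \ell\le k$. Let $m_1,\dots,m_k$ be positive integers such that exactly $\ell$ of them are odd and $k-\ell$ of them are even, and put $N_{k,\ell}=\sum_{i=1}^k m_i-2k+\ell+2$. Then there exists a unital associative $F$-algebra $A$ such that: (i) $T^{(1+N_{k,\ell})}(A)=0$, i.e. $[u_1,\dots,u_{1+N_{k,\ell}}]=0$ for all $u_i\in A$ ($A$ is Lie nilpotent of class at most $N_{k,\ell}$); (ii) there exist elements $v_{ij}\in A$ ($1\le i\le k$, $1\le j\le m_i$) such that \[ [v_{11},\dots,v_{1m_1}]\,[v_{21},\dots,v_{2m_2}]\cdots[v_{k1},\dots,v_{km_k}]\neq 0. \]
   Context: For an associative algebra $A$, left-normed commutators are defined by $[a_1,a_2]=a_1a_2-a_2a_1$ and $[a_1,\dots,a_{n-1},a_n]=[[a_1,\dots,a_{n-1}],a_n]$ for $n\ge 3$; a commutator $[a_1]$ of length one is just $a_1$. For $n\ge 2$, $T^{(n)}(A)$ denotes the two-sided ideal of $A$ generated by all commutators $[a_1,\dots,a_n]$ with $a_i\in A$, and $T^{(1)}(A)=A$. *)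

(* Defs.v *)
From HB Require Import structures.
From mathcomp Require Import all_boot all_order all_algebra.
Set Implicit Arguments. Unset Strict Implicit. Unset Printing Implicit Defensive.
Import GRing.Theory.
Local Open Scope ring_scope.

Definition lcomm (R : ringType) (s : seq R) : R :=
  match s with
  | [::] => 0
  | a :: t => foldl (fun x y => x * y - y * x) a t
  end.

(* Membership in T^(n)(A): the two-sided ideal generated by all left-normed
   commutators of length n (for n = 1 this is A itself). *)
Inductive inT (R : ringType) (n : nat) : R -> Prop :=
  | inT0 : inT n 0
  | inT_gen (a b : R) (u : seq R) : size u = n -> inT n (a * lcomm u * b)
  | inT_add (x y : R) : inT n x -> inT n y -> inT n (x + y).

(* Main.v *)
(** Since [v_1, v_2, ..., v_m] has length m - 1 in [v_1, v_2], v_3, ..., v_m, one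
may replace every odd m_i by m_i + 1; write the new lengths as 2 r_i + 2, and put
r = r_1 + ... + r_k, so that N = 2 r + 2.

Let B satisfy [B, B, B] = 0 and contain n pairs (g_i, h_i) with
[g_1, h_1] ... [g_n, h_n] <> 0.  Tensor B with r copies of the algebra with basis
1, x, y, t, where xy = t and all other products of x, y, t vanish.  Modulo the
ideal J = (t_1, ..., t_r) the result A still has class 2, so double commutators
send J^j to J^(j+1), and J^(r+1) = 0 gives class 2 r + 2.  On the other hand
[c g, h x, g' y] = c [g, h] t g' for c central, so one commutator of length
2 r_i + 2 is a product of r_i of the t's and r_i + 1 of the [g, h]'s, and all of
them multiply to t_1 ... t_r [g_1, h_1] ... [g_n, h_n] <> 0.

The algebra B is a tower of extensions keeping a law [a, b] = kappa d(a) d(b),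
where d is a twisted derivation with d(d(a) d(b)) = 0.  In characteristic 2, d is
an ordinary derivation of square zero and kappa = 1; otherwise d = 1 - s with s an
involution (the parity of a Grassmann algebra), and kappa = 1/2. *)

Require Import Defs.
From HB Require Import structures.
From mathcomp Require Import all_boot all_order all_algebra.
Set Implicit Arguments. Unset Strict Implicit. Unset Printing Implicit Defensive.
Import GRing.Theory.
Local Open Scope ring_scope.

(** * Cancellation in sums of noncommutative monomials *)

Ltac zmod_front t :=
  lazymatch goal with
  | |- t + _ = _ => idtac
  | _ => rewrite (addrCA _ t); zmod_front t
  end.
Ltac zmod_cancel :=
  lazymatch goal with
  | |- 0 = 0 => reflexivity
  | |- - ?t + _ = _ => zmod_front t; rewrite addNKr; zmod_cancel
  | |- ?t + _ = _ => zmod_front (- t); rewrite addKr; zmod_cancel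
  end.
(* The rings here are not commutative, so [ring] does not apply: [zmod] treats the
   monomials as atoms and only reorders and cancels summands. *)
Ltac zmod :=
  apply/eqP; rewrite -subr_eq0; apply/eqP; rewrite -[LHS]addr0;
  rewrite ?opprD ?opprK ?oppr0 -?addrA ?add0r; zmod_cancel.

(** * Algebras with a twisted derivation *)

Definition bracket (R : pzRingType) (x y : R) := x * y - y * x.

(** One record serves both characteristics: with s = [tws] the identity, [twd] is the ordinary
    derivation of characteristic 2; otherwise [twd] is zero and the d of the law is 1 - s. *)
Record twist (F : fieldType) (B : algType F) := Twist {
  tws : B -> B;
  twd : B -> B;
  _ : linear tws;
  _ : linear twd;
  _ : tws 1 = 1;
  _ : {morph tws : a b / a * b};
  _ : forall a b, twd (a * b) = a * twd b + twd a * tws b;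
  _ : forall a, tws (tws a) = a;
  _ : forall a, twd (twd a) = 0;
  _ : forall a, twd (tws a) = - tws (twd a) }.

Section TwistTheory.
Variables (F : fieldType) (B : algType F) (tau : twist B).
Local Notation s := (tws tau).
Local Notation D := (twd tau).
Lemma tws_linear : linear s. Proof. by case: tau. Qed.
HB.instance Definition _ := GRing.isLinear.Build F B B *:%R s tws_linear.
Lemma twd_linear : linear D. Proof. by case: tau. Qed.
HB.instance Definition _ := GRing.isLinear.Build F B B *:%R D twd_linear.
Lemma tws1 : s 1 = 1. Proof. by case: tau. Qed.
Lemma twsM : {morph s : a b / a * b}. Proof. by case: tau. Qed.
Lemma twdM a b : D (a * b) = a * D b + D a * s b. Proof. by case: tau. Qed.
Lemma twsK a : s (s a) = a. Proof. by case: tau. Qed.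
Lemma twdd a : D (D a) = 0. Proof. by case: tau. Qed.
Lemma twds a : D (s a) = - s (D a). Proof. by case: tau. Qed.
Lemma tws0 : s 0 = 0. Proof. exact: raddf0. Qed.
Lemma twd0 : D 0 = 0. Proof. exact: raddf0. Qed.
Lemma twsD a b : s (a + b) = s a + s b. Proof. exact: raddfD. Qed.
Lemma twsN a : s (- a) = - s a. Proof. exact: raddfN. Qed.
Lemma twsZ k a : s (k *: a) = k *: s a. Proof. exact: linearZ. Qed.
Lemma twsMn a n : s (a *+ n) = s a *+ n. Proof. exact: raddfMn. Qed.
Lemma twdD a b : D (a + b) = D a + D b. Proof. exact: raddfD. Qed.
Lemma twdN a : D (- a) = - D a. Proof. exact: raddfN. Qed.
Lemma twdZ k a : D (k *: a) = k *: D a. Proof. exact: linearZ. Qed.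
Lemma twd1 : D 1 = 0.
Proof. by apply: (addrI (D 1)); rewrite addr0 -{3}[1]mulr1 twdM tws1 mul1r mulr1. Qed.
End TwistTheory.

(** * The square-zero extension by e and eps *)

(* B + B e + B eps, where e a = a e + D(a) eps, eps a = s(a) eps, and the products of
   e and eps among themselves vanish. *)
Definition ext3 (F : fieldType) (B : algType F) (tau : twist B) : Type := (B * B * B)%type.

Section Ext3.
Variables (F : fieldType) (B : algType F) (tau : twist B).
Local Notation s := (tws tau).
Local Notation D := (twd tau).
Local Notation T := (ext3 tau).
HB.instance Definition _ := GRing.Lmodule.copy T (B * B * B)%type.

Definition ext3_one : T := (1, 0, 0).
Definition ext3_mul (x y : T) : T :=
  (x.1.1 * y.1.1, x.1.1 * y.1.2 + x.1.2 * y.1.1,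
   x.1.1 * y.2 + x.1.2 * D y.1.1 + x.2 * s y.1.1).

Lemma ext3_addE (x y : T) : x + y = (x.1.1 + y.1.1, x.1.2 + y.1.2, x.2 + y.2).
Proof. by []. Qed.
Lemma ext3_scaleE k (x : T) : k *: x = (k *: x.1.1, k *: x.1.2, k *: x.2).
Proof. by []. Qed.

(** Comparing (e a) b with e (a b) gives the twisted Leibniz rule, and the same for eps gives
    multiplicativity of s. *)
Lemma ext3_mulA : associative ext3_mul.
Proof.
move=> x y z; rewrite /ext3_mul /= !twsM !twdM !mulrDr !mulrDl !mulrA.
by congr (_, _, _); zmod.
Qed.
Lemma ext3_mul1x : left_id ext3_one ext3_mul.
Proof. by case=> -[a b] c; rewrite /ext3_mul /= !mul1r !mul0r !addr0. Qed.
Lemma ext3_mulx1 : right_id ext3_one ext3_mul.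
Proof. by case=> -[a b] c; rewrite /ext3_mul /= tws1 twd1 !mulr1 !mulr0 !add0r. Qed.
Lemma ext3_mulDl : left_distributive ext3_mul +%R.
Proof.
move=> x y z; rewrite !ext3_addE /ext3_mul /= !mulrDl.
by congr (_, _, _); zmod.
Qed.
Lemma ext3_mulDr : right_distributive ext3_mul +%R.
Proof.
move=> x y z; rewrite !ext3_addE /ext3_mul /= !raddfD !mulrDr.
by congr (_, _, _); zmod.
Qed.
Lemma ext3_1neq0 : ext3_one != 0.
Proof. by apply/eqP => -[/eqP]; rewrite oner_eq0. Qed.

HB.instance Definition _ := GRing.Zmodule_isNzRing.Build T
  ext3_mulA ext3_mul1x ext3_mulx1 ext3_mulDl ext3_mulDr ext3_1neq0.

Lemma ext3_mulE (x y : T) : x * y = (x.1.1 * y.1.1, x.1.1 * y.1.2 + x.1.2 * y.1.1,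
   x.1.1 * y.2 + x.1.2 * D y.1.1 + x.2 * s y.1.1).
Proof. by []. Qed.

Lemma ext3_scaleAl k (x y : T) : k *: (x * y) = (k *: x : T) * y.
Proof. by rewrite [RHS]ext3_mulE ext3_mulE !ext3_scaleE /= !scalerDr -!scalerAl. Qed.
HB.instance Definition _ := GRing.Lmodule_isLalgebra.Build F T ext3_scaleAl.
Lemma ext3_scaleAr k (x y : T) : k *: (x * y) = x * (k *: y).
Proof. by rewrite [RHS]ext3_mulE ext3_mulE !ext3_scaleE /= !linearZ /= !scalerDr -!scalerAr. Qed.
HB.instance Definition _ := GRing.Lalgebra_isAlgebra.Build F T ext3_scaleAr.

Definition ext3_in (a : B) : T := (a, 0, 0).
Lemma ext3_in_linear : linear ext3_in.
Proof. by move=> k a b; rewrite /ext3_in ext3_addE ext3_scaleE /= !scaler0 !addr0. Qed.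
HB.instance Definition _ := GRing.isLinear.Build F B T *:%R ext3_in ext3_in_linear.
Lemma ext3_in_monoid : monoid_morphism ext3_in.
Proof.
by split=> // a b; rewrite ext3_mulE /ext3_in /= !mulr0 !mul0r !addr0.
Qed.
HB.instance Definition _ := GRing.isMonoidMorphism.Build B T ext3_in ext3_in_monoid.

Lemma bracket3E (x y : T) : bracket x y = (bracket x.1.1 y.1.1,
  bracket x.1.1 y.1.2 + bracket x.1.2 y.1.1,
  (x.1.1 * y.2 + x.1.2 * D y.1.1 + x.2 * s y.1.1)
  - (y.1.1 * x.2 + y.1.2 * D x.1.1 + y.2 * s x.1.1)).
Proof.
rewrite /bracket [x * y]ext3_mulE [y * x]ext3_mulE; congr (_, _, _) => /=.
by zmod.
Qed.

Variable nu : F.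
(* The extended twist has s(e) = e, s(eps) = - eps, D(e) = nu eps, D(eps) = 0. *)
Definition tws3 (x : T) : T := (s x.1.1, s x.1.2, - s x.2).
Definition twd3 (x : T) : T := (D x.1.1, D x.1.2, nu *: x.1.2 - D x.2).

Lemma tws3_linear : linear tws3.
Proof.
by move=> k x y; rewrite /tws3 !ext3_addE !ext3_scaleE /= !linearP.
Qed.
Lemma twd3_linear : linear twd3.
Proof.
move=> k x y; rewrite /twd3 !ext3_addE !ext3_scaleE /= ![D _]linearP.
congr (_, _, _); rewrite [in RHS]scalerBr scalerDr !scalerA mulrC.
by zmod.
Qed.
Lemma tws3_1 : tws3 1 = 1.
Proof. by rewrite /tws3 /= tws1 !raddf0. Qed.
(** Applying s to e a = a e + D(a) eps, the sign in s(eps) = - eps is matched by D s = - s D. *)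
Lemma tws3M : {morph tws3 : x y / x * y}.
Proof.
move=> x y; rewrite !ext3_mulE /tws3 /= !twsD !twsM !twds twsK.
by congr (_, _, _); rewrite ?mulrN ?mulNr; zmod.
Qed.
(** Applying D to e a = a e + D(a) eps, the two sides agree because D^2 = 0 and s^2 = 1. *)
Lemma twd3M x y : twd3 (x * y) = x * twd3 y + twd3 x * tws3 y.
Proof.
rewrite !ext3_mulE /twd3 /tws3 ext3_addE /= scalerDr !twdD !twdM !twds !twdd twsK.
congr (_, _, _); rewrite ?mulr0 ?add0r ?mulrDr ?mulrDl ?mulrN ?mulNr -?scalerAr -?scalerAl;
  zmod.
Qed.
Lemma tws3K x : tws3 (tws3 x) = x.
Proof. by case: x => -[a b] c; rewrite /tws3 /= raddfN /= opprK !twsK. Qed.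
Lemma twd3d x : twd3 (twd3 x) = 0.
Proof. by rewrite /twd3 /= !twdd twdD twdN twdZ twdd oppr0 addr0 subrr. Qed.
Lemma twd3s x : twd3 (tws3 x) = - tws3 (twd3 x).
Proof.
rewrite /twd3 /tws3 /= !twds twsD !twsN twsZ twdN twds.
by congr (_, _, _); rewrite !opprD !opprK.
Qed.
Definition twist3 : twist T :=
  Twist tws3_linear twd3_linear tws3_1 tws3M twd3M tws3K twd3d twd3s.

End Ext3.

(** * Commutator laws preserved by the extension *)

Section Laws.
Variable F : fieldType.

(* The invariants of the tower in characteristic 2 and in the other characteristics. *)
Definition law2 (B : algType F) (tau : twist B) :=
  (forall x, tws tau x = x) /\ (forall x y, bracket x y = twd tau x * twd tau y).
Definition law0 (B : algType F) (tau : twist B) :=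
  (forall x, twd tau x = 0) /\
  (forall x y, bracket x y *+ 2 = (x - tws tau x) * (y - tws tau y)).
Definition class2 (R : pzRingType) := forall x y z : R, bracket (bracket x y) z = 0.

(** The Leibniz rule and D^2 = 0 give D(D(x) D(y)) = 0. *)
Lemma law2_class2 (B : algType F) (tau : twist B) : law2 tau -> class2 B.
Proof. by case=> _ h x y z; rewrite !h twdM !twdd mulr0 mul0r addr0 mul0r. Qed.

Lemma mulr2_inj (B : algType F) : 2%:R != 0 :> F -> injective (fun x : B => x *+ 2).
Proof. by move=> n2 x y; rewrite -!(scaler_nat 2); apply: scalerI. Qed.

(** 2[x, y] is a product of two elements negated by s, so s fixes it; hence 1 - s kills [x, y]. *)
Lemma law0_class2 (B : algType F) (tau : twist B) :
  2%:R != 0 :> F -> law0 tau -> class2 B.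
Proof.
move=> n2 [_ h] x y z; apply: (mulr2_inj n2); rewrite mul0rn h.
suff -> : tws tau (bracket x y) = bracket x y by rewrite subrr mul0r.
apply: (mulr2_inj n2); rewrite -[LHS]twsMn h twsM !twsD !twsN !twsK.
by rewrite -mulrNN !opprB.
Qed.

(** Every D(a) is central since D^2 = 0. The noncommutation of e with B adds the cross terms b D(a')
    and D(a) b' to the eps coordinate; D(e) = eps, that is nu = 1, reproduces them, and signs do not
    matter in characteristic 2. *)
Lemma law2_step (B : algType F) (tau : twist B) :
  2%:R = 0 :> F -> law2 tau -> law2 (twist3 tau 1).
Proof.
move=> n2 [hs h].
have oppB (a : B) : - a = a.
  by apply/eqP; rewrite -subr_eq0 -opprD -mulr2n -scaler_nat n2 scale0r oppr0.
have cd a b : twd tau a * b = b * twd tau a.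
  by apply/eqP; rewrite -subr_eq0 [X in X == 0]h twdd mul0r.
split=> [[[a b] c]|x y]; first by rewrite /= /tws3 /= !hs oppB.
have third a b c a' b' c' : a * c' + b * twd tau a' + c * a' -
    (a' * c + b' * twd tau a + c' * a) =
    bracket a c' + bracket c a' + b * twd tau a' - twd tau a * b'.
  by rewrite (cd a b') /bracket; zmod.
rewrite bracket3E !hs third !h ext3_mulE /= /twd3 /= !hs !twdd; congr (_, _, _).
by rewrite !oppB !scale1r mulr0 addr0 mulrDr mulrDl; zmod.
Qed.

(** As s(eps) = - eps, on the eps coordinate 1 - s becomes 1 + s; the correction terms c' (a - s(a))
    and c (a' - s(a')) turn the minus of the law in B into this plus. *)
Lemma law0_step (B : algType F) (tau : twist B) : law0 tau -> law0 (twist3 tau 0).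
Proof.
move=> [hD h].
split=> [[[a b] c]|x y]; first by rewrite /= /twd3 /= !hD scale0r subrr.
have sd a : tws tau (a - tws tau a) = - (a - tws tau a).
  by rewrite twsD twsN twsK opprB.
(* Odd elements supercommute: u - s(u) = 2u, so the law for (u, c) reads 2[u, c] = 2u (c - s(c)). *)
have dC u c : tws tau u = - u -> (c * u) *+ 2 = (u * tws tau c) *+ 2.
  move=> su; have := h u c; rewrite su opprK -mulr2n /bracket mulrnAl mulrBr !mulrnBl.
  by move=> /addrI/oppr_inj.
have third a c a' c' : a * c' + c * tws tau a' - (a' * c + c' * tws tau a) =
    (bracket a c' + bracket c a') + (c' * (a - tws tau a) - c * (a' - tws tau a')).
  by rewrite /bracket !mulrBr; zmod.
rewrite bracket3E !hD !mulr0 !addr0 third ext3_mulE /= /tws3 /= !hD sd opprK mulr0 addr0.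
have -> (u v w : B) : ((u, v, w) : ext3 tau) *+ 2 = (u *+ 2, v *+ 2, w *+ 2) by [].
have h2 a b c d : (bracket a b + bracket c d) *+ 2 =
    (a - tws tau a) * (b - tws tau b) + (c - tws tau c) * (d - tws tau d).
  by rewrite mulrnDl !h.
rewrite [X in (_, _, X) = _]mulrnDl h !h2 mulrnBl (dC (x.1.1 - _)) ?sd //; congr (_, _, _).
by rewrite !(mulrN, mulNr, opprK, mulrDr, mulrDl) !mulr2n; zmod.
Qed.
End Laws.

(** * Class 2 algebras with long nonzero products of commutators *)

Lemma rmorph_bracket (R S : pzRingType) (f : {rmorphism R -> S}) x y :
  f (bracket x y) = bracket (f x) (f y).
Proof. by rewrite /bracket rmorphB !rmorphM. Qed.

Definition prod_bracket (R : pzRingType) (e : seq (R * R)) : R :=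
  \prod_(p <- e) bracket p.1 p.2.

Lemma rmorph_prod_bracket (R S : pzRingType) (f : {rmorphism R -> S}) e :
  f (prod_bracket e) = prod_bracket [seq (f p.1, f p.2) | p <- e].
Proof.
by rewrite /prod_bracket rmorph_prod big_map; apply: eq_bigr => p _; rewrite rmorph_bracket.
Qed.

Section Class2.
Variable F : fieldType.

(** The bottom of both towers. It is left transparent so that the laws can be checked there by
    computation. *)
Definition trivial_twist : twist (F^o : algType F).
Proof.
apply: (@Twist F F^o id (fun=> 0)) => //.
- by move=> k a b; rewrite scaler0 addr0.
- by move=> a b; rewrite mulr0 mul0r addr0.
- by move=> a; rewrite oppr0.
Defined.

Lemma ext3_in_mul0 (B : algType F) (tau : twist B) a c :
  ext3_in tau a * ((0, 0, c) : ext3 tau) = (0, 0, a * c).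
Proof. by rewrite ext3_mulE /= !(mulr0, mul0r, addr0). Qed.

Lemma bracket_ext3_in (B : algType F) (tau : twist B) u :
  bracket (ext3_in tau u) ((0, 1, 1) : ext3 tau) = (0, 0, u - (twd tau u + tws tau u)).
Proof.
by rewrite bracket3E /bracket /= !(mulr0, mul0r, mulr1, mul1r, addr0, add0r, subrr, oppr0).
Qed.

(** Two extensions yield one new pair: u = e + eps from the first and e' + eps' from the second.
    Then [u, e' + eps'] = (u - D(u) - s(u)) eps' = (2 - nu) eps eps', so the old product survives as
    its coefficient. *)
Lemma class2_tower (nu : F) (law : forall B : algType F, twist B -> Prop) :
  2%:R - nu != 0 -> law _ trivial_twist ->
  (forall B (tau : twist B), law B tau -> law _ (twist3 tau nu)) ->
  (forall B (tau : twist B), law B tau -> class2 B) ->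
  forall n, exists (B : algType F) (e : seq (B * B)),
    [/\ class2 B, size e = n & prod_bracket e != 0].
Proof.
move=> nu2 law1 lawS law_class2 n.
suff [B [tau [e [lB se ne]]]] : exists (B : algType F) (tau : twist B) (e : seq (B * B)),
    [/\ law B tau, size e = n & prod_bracket e != 0].
  by exists B, e; split=> //; apply: law_class2 lB.
elim: n => [|n [B [tau [e [lB se ne]]]]].
  by exists F^o, trivial_twist, [::]; rewrite /prod_bracket big_nil oner_neq0.
pose tau1 := twist3 tau nu; pose f := ext3_in tau1 \o ext3_in tau.
pose u : ext3 tau := (0, 1, 1).
exists (ext3 tau1), (twist3 tau1 nu),
  (rcons [seq (f p.1, f p.2) | p <- e] (ext3_in tau1 u, (0, 1, 1) : ext3 tau1)).
split; [exact/lawS/lawS | by rewrite size_rcons size_map se |].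
have -> : prod_bracket (rcons [seq (f p.1, f p.2) | p <- e]
    (ext3_in tau1 u, (0, 1, 1) : ext3 tau1)) =
  f (prod_bracket e) * bracket (ext3_in tau1 u) ((0, 1, 1) : ext3 tau1).
  rewrite [f _](rmorph_prod_bracket (ext3_in tau1 \o ext3_in tau)).
  by rewrite /prod_bracket big_rcons.
have uE : u - (twd tau1 u + tws tau1 u) = (0, 0, (2%:R - nu) *: 1).
  rewrite /= /twd3 /tws3 /= tws1 twd1 twd0 tws0 subr0 ext3_addE /= !add0r.
  by congr (_, _, _); rewrite ?oppr0 ?subrr // scalerBl scaler_nat mulr2n; zmod.
rewrite bracket_ext3_in uE /f /= !ext3_in_mul0.
apply/eqP => -[] /eqP; rewrite -scalerAr mulr1 scaler_eq0 (negPf nu2) /= => /eqP pe0.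
by rewrite pe0 eqxx in ne.
Qed.

Lemma class2_exists n : exists (B : algType F) (e : seq (B * B)),
  [/\ class2 B, size e = n & prod_bracket e != 0].
Proof.
(* Both choices keep 2 - nu nonzero: nu = 1 in characteristic 2, and nu = 0, which preserves D = 0,
   otherwise. *)
have [n2|n2] := eqVneq (2%:R : F) 0.
- apply: (@class2_tower 1 (@law2 F)); rewrite ?n2 ?sub0r ?oppr_eq0 ?oner_neq0 //.
  + by split=> // x y; rewrite mul0r /bracket mulrC subrr.
  + by move=> B tau; apply: law2_step.
  + by move=> B tau; apply: law2_class2.
- apply: (@class2_tower 0 (@law0 F)); rewrite ?subr0 //.
  + by split=> // x y; rewrite !subrr mul0r /bracket mulrC subrr mul0rn.
  + by move=> B tau; apply: law0_step.
  + by move=> B tau; apply: law0_class2.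
Qed.

End Class2.

(** * Tensoring with the algebra of basis 1, x, y, t *)

(* The tensor product of B with the algebra of basis 1, x, y, t = xy, stored as the
   coefficients (a, b, f, c) of 1, x, y, t. *)
Definition ext4 (F : fieldType) (B : algType F) : Type := (B * B * B * B)%type.

Section Ext4.
Variables (F : fieldType) (B : algType F).
Local Notation T := (ext4 B).
HB.instance Definition _ := GRing.Lmodule.copy T (B * B * B * B)%type.

Definition ext4_one : T := (1, 0, 0, 0).
Definition ext4_mul (x y : T) : T :=
  (x.1.1.1 * y.1.1.1, x.1.1.1 * y.1.1.2 + x.1.1.2 * y.1.1.1,
   x.1.1.1 * y.1.2 + x.1.2 * y.1.1.1,
   x.1.1.1 * y.2 + x.1.1.2 * y.1.2 + x.2 * y.1.1.1).

Lemma ext4_addE (x y : T) :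
  x + y = (x.1.1.1 + y.1.1.1, x.1.1.2 + y.1.1.2, x.1.2 + y.1.2, x.2 + y.2).
Proof. by []. Qed.
Lemma ext4_scaleE k (x : T) : k *: x = (k *: x.1.1.1, k *: x.1.1.2, k *: x.1.2, k *: x.2).
Proof. by []. Qed.

Lemma ext4_mulA : associative ext4_mul.
Proof.
move=> x y z; rewrite /ext4_mul /= !mulrDr !mulrDl !mulrA.
by congr (_, _, _, _); zmod.
Qed.
Lemma ext4_mul1x : left_id ext4_one ext4_mul.
Proof. by case=> -[[a b] f] c; rewrite /ext4_mul /= !mul1r !mul0r !addr0. Qed.
Lemma ext4_mulx1 : right_id ext4_one ext4_mul.
Proof. by case=> -[[a b] f] c; rewrite /ext4_mul /= !mulr1 !mulr0 !add0r. Qed.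
Lemma ext4_mulDl : left_distributive ext4_mul +%R.
Proof.
move=> x y z; rewrite !ext4_addE /ext4_mul /= !mulrDl.
by congr (_, _, _, _); zmod.
Qed.
Lemma ext4_mulDr : right_distributive ext4_mul +%R.
Proof.
move=> x y z; rewrite !ext4_addE /ext4_mul /= !mulrDr.
by congr (_, _, _, _); zmod.
Qed.
Lemma ext4_1neq0 : ext4_one != 0.
Proof. by apply/eqP => -[/eqP]; rewrite oner_eq0. Qed.

HB.instance Definition _ := GRing.Zmodule_isNzRing.Build T
  ext4_mulA ext4_mul1x ext4_mulx1 ext4_mulDl ext4_mulDr ext4_1neq0.

Lemma ext4_mulE (x y : T) : x * y = (x.1.1.1 * y.1.1.1,
  x.1.1.1 * y.1.1.2 + x.1.1.2 * y.1.1.1, x.1.1.1 * y.1.2 + x.1.2 * y.1.1.1,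
  x.1.1.1 * y.2 + x.1.1.2 * y.1.2 + x.2 * y.1.1.1).
Proof. by []. Qed.

Lemma ext4_scaleAl k (x y : T) : k *: (x * y) = (k *: x : T) * y.
Proof. by rewrite [RHS]ext4_mulE ext4_mulE !ext4_scaleE /= !scalerDr -!scalerAl. Qed.
HB.instance Definition _ := GRing.Lmodule_isLalgebra.Build F T ext4_scaleAl.
Lemma ext4_scaleAr k (x y : T) : k *: (x * y) = x * (k *: y).
Proof. by rewrite [RHS]ext4_mulE ext4_mulE !ext4_scaleE /= !scalerDr -!scalerAr. Qed.
HB.instance Definition _ := GRing.Lalgebra_isAlgebra.Build F T ext4_scaleAr.

Definition ext4_in (a : B) : T := (a, 0, 0, 0).
Lemma ext4_in_linear : linear ext4_in.
Proof. by move=> k a b; rewrite /ext4_in ext4_addE ext4_scaleE /= !scaler0 !addr0. Qed.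
HB.instance Definition _ := GRing.isLinear.Build F B T *:%R ext4_in ext4_in_linear.
Lemma ext4_in_monoid : monoid_morphism ext4_in.
Proof. by split=> // a b; rewrite ext4_mulE /ext4_in /= !mulr0 !mul0r !addr0. Qed.
HB.instance Definition _ := GRing.isMonoidMorphism.Build B T ext4_in ext4_in_monoid.

Lemma bracket4E (x y : T) : bracket x y = (bracket x.1.1.1 y.1.1.1,
  bracket x.1.1.1 y.1.1.2 + bracket x.1.1.2 y.1.1.1,
  bracket x.1.1.1 y.1.2 + bracket x.1.2 y.1.1.1,
  bracket x.1.1.1 y.2 + (x.1.1.2 * y.1.2 - y.1.1.2 * x.1.2) + bracket x.2 y.1.1.1).
Proof.
rewrite /bracket [x * y]ext4_mulE [y * x]ext4_mulE.
by congr (_, _, _, _) => /=; zmod.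
Qed.

Definition ext4_x : T := (0, 1, 0, 0).
Definition ext4_y : T := (0, 0, 1, 0).
Lemma bracket_ext4_xy : bracket ext4_x ext4_y = (0, 0, 0, 1).
Proof.
by rewrite bracket4E /bracket /= !(mulr0, mul0r, mul1r, oppr0, addr0, add0r).
Qed.
Lemma ext4_x_comm a : GRing.comm (ext4_in a) ext4_x.
Proof.
by rewrite /GRing.comm [LHS]ext4_mulE ext4_mulE /= !(mulr0, mul0r, mulr1, mul1r, addr0, add0r).
Qed.
Lemma ext4_y_comm a : GRing.comm (ext4_in a) ext4_y.
Proof.
by rewrite /GRing.comm [LHS]ext4_mulE ext4_mulE /= !(mulr0, mul0r, mulr1, mul1r, addr0, add0r).
Qed.
Lemma ext4_xy_central z : GRing.comm (bracket ext4_x ext4_y) z.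
Proof.
by rewrite bracket_ext4_xy /GRing.comm [LHS]ext4_mulE ext4_mulE /=
  !(mulr0, mul0r, mulr1, mul1r, addr0, add0r).
Qed.
Lemma ext4_in_central a : (forall z, GRing.comm a z) -> forall z, GRing.comm (ext4_in a) z.
Proof.
move=> ca [[[b c] d] e].
by rewrite /GRing.comm [LHS]ext4_mulE ext4_mulE /= !(mulr0, mul0r, addr0, add0r) !ca.
Qed.
Lemma ext4_in_xy a : ext4_in a * bracket ext4_x ext4_y = (0, 0, 0, a).
Proof. by rewrite bracket_ext4_xy ext4_mulE /= !(mulr0, mul0r, mulr1, addr0, add0r). Qed.
End Ext4.

(** * Filtrations and the construction of A *)

(* The filtration by powers of J in the introduction, for which I_n = 0. *)
Definition lie_filtration (R : pzRingType) (n : nat) (I : nat -> R -> Prop) :=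
  [/\ (forall x, I 0%N x) /\ (forall j x, I j.+1 x -> I j x),
      forall j x y, I j x -> I j y -> I j (x - y),
      forall j x y, I j x -> I j (x * y) /\ I j (y * x),
      forall j x y z, I j x -> I j.+1 (bracket (bracket x y) z)
    & forall x, I n x -> x = 0].

Lemma class2_filtration (R : pzRingType) : class2 R ->
  lie_filtration 1 (fun j (x : R) => (j == 0)%N \/ x = 0).
Proof.
move=> c2; split; first by split=> [x|j x [|->]]; by [left|right].
- by move=> j x y [j0|->]; [left | case=> [j0|->]; [left | right; rewrite subr0]].
- by move=> j x y [->|->]; rewrite ?mulr0 ?mul0r; split; by [left|right].
- by move=> j x y z _; right; apply: c2.
- by move=> x [].
Qed.

Section Filtration4.
Variables (F : fieldType) (B : algType F) (n : nat) (I : nat -> B -> Prop).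
Hypothesis filtI : lie_filtration n I.

(** The new t has weight one and x, y weight zero, so the coefficient of t may lie one step earlier.
    At j = 0 the truncated predecessor is harmless, as I 0 is everything. *)
Definition filtration4 j (x : ext4 B) :=
  [/\ I j x.1.1.1, I j x.1.1.2, I j x.1.2 & I j.-1 x.2].

Lemma ext4_filtration : lie_filtration n.+1 filtration4.
Proof.
case: filtI => -[I0 Idec] IB IM IC In.
have Ip j x : I j x -> I j.-1 x by case: j => // j; apply: Idec.
have I00 j x : I j x -> I j 0 by move=> Ix; rewrite -(subrr x); apply: IB.
have IN j x : I j x -> I j (- x) by move=> Ix; rewrite -sub0r; apply: IB => //; apply: I00 Ix.
have ID j x y : I j x -> I j y -> I j (x + y).
  by move=> Ix Iy; rewrite -[y]opprK; apply/IB/IN.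
have Ml j x y : I j x -> I j (x * y) by move=> /(IM _ _ y)[].
have Mr j x y : I j x -> I j (y * x) by move=> /(IM _ _ y)[].
have Cl j x y : I j x -> I j (bracket x y) by move=> Ix; apply: IB; [apply: Ml|apply: Mr].
(* For the t coordinate of a double commutator: only the term starting from the t coefficient of x
   begins in I (j - 1); all others have a factor in I j. *)
have C2 j x y z : I j.-1 x -> I j (bracket (bracket x y) z).
  by case: j => [|j] Ix; [apply: I0 | apply: (IC)].
have bracketDl (x y z : B) : bracket (x + y) z = bracket x z + bracket y z.
  by rewrite /bracket mulrDl mulrDr; zmod.
split; first split.
- by move=> x; split; apply: I0.
- by move=> j x [? ? ? Ic]; split; [exact: Idec ..| exact: Ip].
- by move=> j x y [? ? ? ?] [? ? ? ?]; split; apply: IB.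
- by move=> j x y [Ia Ib If Ic]; split; rewrite ext4_mulE; split=> /=;
    do ?apply: (ID); (by apply: Ml) || (by apply: Mr) || (by apply/Ml/Ip) || (by apply/Mr/Ip).
- move=> j x y z [Ia Ib If Ic]; rewrite !bracket4E /=; split=> /=.
  + exact: IC.
  + by apply: (ID); [exact: IC | rewrite (bracketDl (bracket _ _)); apply: (ID); apply: (IC)].
  + by apply: (ID); [exact: IC | rewrite (bracketDl (bracket _ _)); apply: (ID); apply: (IC)].
  + apply: (ID); first apply: (ID); first by do 2!apply: (Cl).
      by apply: IB; [apply: Ml | apply: Mr]; apply: (ID); apply: (Cl).
    rewrite (bracketDl (_ + _) (bracket _ _)) (bracketDl (bracket _ _) (_ - _)).
    apply: (ID); last exact: C2.
    by apply: (ID); apply: (Cl); [apply: (Cl) | apply: IB; [apply: Ml | apply: Mr]].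
- by move=> [[[a b] f] c] [/= /Idec/In -> /Idec/In -> /Idec/In -> /In ->].
Qed.
End Filtration4.

Lemma prod_bracket_nth (R : pzRingType) (e : seq (R * R)) :
  prod_bracket e = \prod_(i < size e) bracket (e`_i).1 (e`_i).2.
Proof. by rewrite /prod_bracket (big_nth 0) big_mkord. Qed.

(** Induction on the number r of tensor factors, starting from a class 2 algebra with n pairs.
    Families over [nat] keep the commutation rules free of index bounds. *)
Lemma tower_exists (F : fieldType) n r :
  exists (A : algType F) (I : nat -> A -> Prop) (g h x y : nat -> A),
  [/\ lie_filtration r.+1 I,
      forall i z, GRing.comm (bracket (g i) (h i)) z,
      forall i z, GRing.comm (bracket (x i) (y i)) z,
      forall i j, [/\ GRing.comm (g i) (x j), GRing.comm (g i) (y j),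
                      GRing.comm (h i) (x j) & GRing.comm (h i) (y j)]
    & \prod_(i < n) bracket (g i) (h i) * \prod_(j < r) bracket (x j) (y j) != 0].
Proof.
elim: r => [|r [A [I [g [h [x [y [filtI gh xy comm ne0]]]]]]]].
  have [B [e [B2 <- ne0]]] := class2_exists F n.
  exists B, (fun j z => (j == 0)%N \/ z = 0), (fun i => (e`_i).1), (fun i => (e`_i).2),
    (fun=> 0), (fun=> 0).
  split=> [|i z|i z|i j|].
  - exact: class2_filtration.
  - by apply/eqP; rewrite -subr_eq0 [X in X == 0]B2.
  - by rewrite /bracket mul0r subrr; apply/commr_sym/commr0.
  - by split; apply: commr0.
  - by rewrite big_ord0 mulr1 -prod_bracket_nth.
pose f := @ext4_in F A.
(* Index r receives the new x and y; the other entries are images of the old ones. *)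
pose x' j := if (j == r)%N then ext4_x A else f (x j).
pose y' j := if (j == r)%N then ext4_y A else f (y j).
have fbr a b : bracket (f a) (f b) = f (bracket a b).
  by rewrite [RHS](rmorph_bracket (@ext4_in F A)).
have fM a b : f (a * b) = f a * f b by exact: (rmorphM (@ext4_in F A)).
have fcomm a b : GRing.comm a b -> GRing.comm (f a) (f b).
  by move=> ab; rewrite /GRing.comm -!fM ab.
exists (ext4 A), (filtration4 I), (f \o g), (f \o h), x', y'.
split=> [|i z|i z|i j|].
- exact: ext4_filtration.
- by rewrite fbr; apply: ext4_in_central.
- rewrite /x' /y'; case: eqP => _; first exact: ext4_xy_central.
  by rewrite fbr; apply: ext4_in_central.
- have [c1 c2 c3 c4] := comm i j; rewrite /x' /y' /=.
  case: eqP => _; split; try exact: fcomm; try exact: ext4_x_comm; exact: ext4_y_comm.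
- have [xr yr] : x' r = ext4_x A /\ y' r = ext4_y A by rewrite /x' /y' eqxx.
  rewrite big_ord_recr /= xr yr.
  have -> : \prod_(i < n) bracket (f (g i)) (f (h i)) = f (\prod_(i < n) bracket (g i) (h i)).
    by rewrite [RHS](rmorph_prod (@ext4_in F A)); apply: eq_bigr => i _; rewrite fbr.
  have -> : \prod_(i < r) bracket (x' i) (y' i) = f (\prod_(i < r) bracket (x i) (y i)).
    rewrite [RHS](rmorph_prod (@ext4_in F A)); apply: eq_bigr => i _.
    by rewrite /x' /y' ltn_eqF // fbr.
  rewrite mulrA -fM ext4_in_xy.
  by apply: contra ne0 => /eqP[->].
Qed.

(** * Evaluation of long commutators *)

(** Two further entries form a double commutator, which gains one step. *)
Lemma filtration_foldl (R : pzRingType) n (I : nat -> R -> Prop) j a (u : seq R) :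
  (forall j x y z, I j x -> I j.+1 (bracket (bracket x y) z)) ->
  I j a -> size u = n.*2 -> I (j + n)%N (foldl (@bracket R) a u).
Proof.
move=> IC; elim: n j a u => [|n IHn] j a; first by case=> //; rewrite addn0.
by case=> [|b [|c u]] //= Ia [su]; rewrite addnS -addSn; apply: IHn => //; apply: IC.
Qed.

Lemma filtration_lcomm (R : nzRingType) n (I : nat -> R -> Prop) (u : seq R) :
  lie_filtration n I -> size u = n.*2.+1 -> lcomm u = 0.
Proof.
case=> -[I0 _] _ _ IC In; case: u => //= a u [su].
by apply: In; rewrite -[n]add0n; apply: filtration_foldl IC _ su.
Qed.

Lemma lcomm_mkseqS (R : nzRingType) (u : nat -> R) n :
  lcomm (mkseq u n.+2) = bracket (lcomm (mkseq u n.+1)) (u n.+1).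
Proof. by rewrite mkseqS /mkseq /= foldl_rcons. Qed.

(** This serves odd lengths: a commutator as first entry absorbs two entries of an even block. *)
Lemma lcomm_mkseq_shift (R : nzRingType) (u : nat -> R) n :
  lcomm (mkseq (fun j => if j is j'.+1 then u j'.+2 else bracket (u 0%N) (u 1%N)) n.+1) =
  lcomm (mkseq u n.+2).
Proof. by elim: n => // n IHn; rewrite [LHS]lcomm_mkseqS IHn [RHS]lcomm_mkseqS. Qed.

Section Blocks.
Variables (R : nzRingType) (g h x y : nat -> R).
Local Notation w i := (bracket (g i) (h i)).
Local Notation t i := (bracket (x i) (y i)).
Hypothesis wC : forall i z, GRing.comm (w i) z.
Hypothesis tC : forall i z, GRing.comm (t i) z.
Hypothesis ghxy : forall i j, [/\ GRing.comm (g i) (x j), GRing.comm (g i) (y j),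
  GRing.comm (h i) (x j) & GRing.comm (h i) (y j)].

(* The sequence g_p, h_p x_q, g_(p+1) y_q, h_(p+1) x_(q+1), ..., g_(p+r) y_(q+r-1),
   h_(p+r), of length 2 r + 2. *)
Definition block p q r (j : nat) : R :=
  if j == 0%N then g p else
  if odd j then
    if j == r.*2.+1 then h (p + r)%N else h (p + j./2)%N * x (q + j./2)%N
  else g (p + j./2)%N * y (q + j./2.-1)%N.

Definition block_prod p q r := \prod_(j < r) (w (p + j)%N * t (q + j)%N).

Lemma block_prod_central p q r z : GRing.comm (block_prod p q r) z.
Proof.
apply/commr_sym/commr_prod => j _; apply/commrM; apply/commr_sym; [exact: wC|exact: tC].
Qed.

(** As c and w_i are central and the g, h commute with the x, y, the inner bracket is c w_i x_j and
    the outer one c w_i t_j g'. This is again central times a g, ready for the next step. *)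
Lemma bracket_step c (i i' j : nat) : (forall z, GRing.comm c z) ->
  bracket (bracket (c * g i) (h i * x j)) (g i' * y j) = c * (w i * t j) * g i'.
Proof.
move=> cC; have [gx _ hx _] := ghxy i j; have [gx' _ _ _] := ghxy i' j.
have -> : bracket (c * g i) (h i * x j) = c * w i * x j.
  rewrite /bracket mulrBr mulrBl !mulrA -[h i * x j * c]cC; congr (_ - _).
  by rewrite -!mulrA gx.
have cwC z : GRing.comm (c * w i) z by apply/commr_sym/commrM; apply/commr_sym.
have step a : (forall z, GRing.comm a z) ->
    bracket (a * x j) (g i' * y j) = a * (g i' * t j).
  move=> aC; rewrite /bracket !mulrBr !mulrA -[g i' * y j * a]aC !mulrA.
  by rewrite -[a * g i' * x j]mulrA gx' !mulrA.
by rewrite step // -(tC j (g i')) !mulrA.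
Qed.

Lemma block_even p q r i : (i <= r)%N ->
  lcomm (mkseq (block p q r) i.*2.+1) = block_prod p q i * g (p + i)%N.
Proof.
elim: i => [|i IHi] ir; first by rewrite /block_prod big_ord0 mul1r addn0.
have ho : block p q r i.*2.+1 = h (p + i)%N * x (q + i)%N.
  by rewrite /block /= odd_double /= eqSS (inj_eq double_inj) ltn_eqF // uphalf_double.
have he : block p q r i.*2.+2 = g (p + i.+1)%N * y (q + i)%N.
  by rewrite /block /= odd_double /= doubleK.
rewrite doubleS 2!lcomm_mkseqS IHi 1?ltnW // ho he bracket_step; last first.
  exact: block_prod_central.
by rewrite [in RHS]/block_prod big_ord_recr.
Qed.

(** The last entry h carries no x, so it closes the block with one more w: r of the t's and r + 1 of
    the w's in all. *)
Lemma block_odd p q r :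
  lcomm (mkseq (block p q r) r.*2.+2) = block_prod p q r * w (p + r)%N.
Proof.
rewrite lcomm_mkseqS block_even // /block /= odd_double /= eqxx.
by rewrite /bracket mulrBr !mulrA [h _ * _](commr_sym (block_prod_central _ _ _ _)).
Qed.

(** Centrality lets the factors of a block be sorted onto the products already built. *)
Lemma block_telescope p q r :
  \prod_(i < p) w i * \prod_(j < q) t j * (block_prod p q r * w (p + r)%N) =
  \prod_(i < (p + r).+1) w i * \prod_(j < q + r) t j.
Proof.
rewrite big_ord_recr /= -[RHS]mulrA wC !mulrA; congr (_ * _).
elim: r => [|r IHr]; first by rewrite /block_prod big_ord0 mulr1 !addn0.
rewrite /block_prod big_ord_recr /= mulrA IHr !addnS !big_ord_recr /=.
by rewrite -!mulrA; congr (_ * _); rewrite !mulrA -wC.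
Qed.
End Blocks.

(** * Lengths and assembly *)

Lemma even_or_odd_length m : (0 < m)%N ->
  (m + odd m)%N = ((uphalf m).-1).*2.+2.
Proof.
move=> m_gt0; rewrite -doubleS prednK ?uphalf_gt0 // uphalf_half doubleD.
by rewrite -{1}(odd_double_half m); case: odd; rewrite /= addnC ?addnA // addn0.
Qed.

Theorem theorem1p9 (F : fieldType) (k l : nat) (m : 'I_k -> nat) :
  (0 < k)%N -> (l <= k)%N ->
  (forall i, (0 < m i)%N) ->
  #|[set i | odd (m i)]| = l ->
  let N := ((\sum_(i < k) m i + l + 2) - 2 * k)%N in
  exists A : algType F,
    (forall x : A, inT (N.+1) x -> x = 0) /\
    (forall u : seq A, size u = N.+1 -> lcomm u = 0) /\
    (exists v : 'I_k -> nat -> A,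
       \prod_(i < k) lcomm (mkseq (v i) (m i)) != 0).
Proof.
move=> _ _ m_gt0 lE N.
(* Reading m through its list of values extends r to all of [nat], with value 0 from k on, for the
   final induction. *)
pose r i := (uphalf (nth 0%N (codom m) i)).-1.
have rE (i : 'I_k) : r i = (uphalf (m i)).-1.
  by rewrite /r (nth_map i) ?nth_ord_enum // size_enum_ord.
(* Block i starts at t-index q i and at w-index q i + i, since each earlier block uses one more w
   than t. *)
pose q n := (\sum_(i < n) r i)%N.
have NE : N.+1 = (q k).+1.*2.+1.
  (* The term l pays for raising each odd length by one. The sum is then that of the 2 r_i + 2, at
     least 2k, so the subtraction is exact and N = 2 q k + 2. *)
  have -> : N = (\sum_(i < k) (m i + odd (m i)) + 2 - 2 * k)%N.
    rewrite /N -lE -sum1_card [X in (_ + X + 2)%N]big_mkcond -big_split /=.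
    by congr (_ + 2 - _)%N; apply: eq_bigr => i _; rewrite inE; case: odd.
  rewrite (eq_bigr (fun i : 'I_k => (r i).*2 + 2)%N) => [|i _]; last first.
    by rewrite rE addn2 -even_or_odd_length //.
  rewrite big_split /= sum_nat_const card_ord [(k * 2)%N]mulnC addnAC addnK.
  rewrite addn2 doubleS -mul2n /q big_distrr /=; congr _.+3.
  by apply: eq_bigr => i _; rewrite mul2n.
have [A [I [g [h [x [y [filtI wC tC ghxy ne0]]]]]]] := tower_exists F (q k + k) (q k).
exists A.
have lcomm0 (u : seq A) : size u = N.+1 -> lcomm u = 0.
  by rewrite NE; apply: filtration_lcomm filtI.
split; last split=> //.
  by move=> z; elim=> // [a b u /lcomm0->|? ? _ -> _ ->]; rewrite ?mulr0 ?mul0r ?addr0.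
pose u i := block g h x y (q i + i) (q i) (r i).
(* For odd m_i the first entry is itself the commutator of the first two block entries. *)
pose v i := if odd (m i) then
  (fun j => if j is j'.+1 then u i j'.+2 else bracket (u i 0%N) (u i 1%N)) else u i.
exists v.
have vE (i : 'I_k) : lcomm (mkseq (v i) (m i)) =
  block_prod g h x y (q i + i) (q i) (r i) * bracket (g (q i + i + r i)%N) (h (q i + i + r i)%N).
  rewrite -block_odd // -/(u i) /v rE; have := even_or_odd_length (m_gt0 i).
  move: (uphalf (m i)).-1 => X; case: odd; last by rewrite addn0 => <-.
  by rewrite addn1 => -[->]; rewrite lcomm_mkseq_shift.
rewrite (eq_bigr _ (fun i _ => vE i)).
(* Stated for every n to allow induction; at n = k the right side is the product known to be
   nonzero. *)
suff -> n : \prod_(i < n) (block_prod g h x y (q i + i) (q i) (r i) *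
    bracket (g (q i + i + r i)%N) (h (q i + i + r i)%N)) =
  \prod_(i < q n + n) bracket (g i) (h i) * \prod_(j < q n) bracket (x j) (y j) by [].
elim: n => [|n IHn]; first by rewrite /q !big_ord0 mulr1.
rewrite big_ord_recr /= IHn block_telescope //.
by rewrite [q n.+1]big_ord_recr /= -/(q n) addnS addnAC.
Qed.
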